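(* Let $\mathcal{A}$ be a linear, essential hyperplane arrangement in $\mathbb{R}^n$, let $0\le k<n$, and let $\mathcal{A}^{(k)}$ be the $k$-adjoint of $\mathcal{A}$. Assume that $P_1,P_2\in L(\mathcal{A}^{(k)})$ with $P_1\le P_2$. If $U_j\in\mathcal{S}_{P_j}$ for $j=1,2$, then for every $i=0,1,\ldots,k$: (1) $I_i(\mathcal{A}|_{U_1})\ge I_i(\mathcal{A}|_{U_2})$; (2) $|w_i(\mathcal{A}|_{U_1})|\ge|w_i(\mathcal{A}|_{U_2})|$.
   Context: **Arrangements.** A hyperplane arrangement $\mathcal{A}$ in $\mathbb{R}^n$ is a finite set of hyperplanes; linear means all hyperplanes pass through $0$, essential means $\bigcap_{H\in\mathcal{A}}H=\{0\}$. For any linear arrangement $\mathcal{A}$ in a vector space $V$, $L(\mathcal{A})$ is the set of all subspaces $\bigcap_{H\in\mathcal{B}}H$, $\mathcal{B}\subseteq\mathcal{A}$ (the empty intersection being $V$), ordered by reverse inclusion: $X\le Y$ iff $Y\subseteq X$. For $X\in L(\mathcal{A})$, $\mathcal{A}$ in $\mathbb{R}^n$, $\mathrm{rank}(X)=n-\dim X$, and $L_k(\mathcal{A})=\{X\in L(\mathcal{A})\mid\mathrm{rank}(X)=k\}$. For $X\in L(\mathcal{A})$ put $X^\circ=X\setminus\bigcup_{Y\in L(\mathcal{A}),\,Y>X}Y$. For a subspace $U$ of $\mathbb{R}^n$, the restriction is the arrangement $\mathcal{A}|_U=\{H\cap U\mid H\in\mathcal{A},\ U\not\subseteq H\}$ in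 $U$ (a set of hyperplanes of $U$). **Plücker coordinates.** $[n]=\{1,\ldots,n\}$; $\binom{[n]}{k}$ is the set of $k$-subsets of $[n]$; $\mathrm{Gr}(k,n)$ is the set of $k$-dimensional subspaces of $\mathbb{R}^n$. For a $d$-dimensional subspace $U$ of $\mathbb{R}^n$, choose a $d\times n$ matrix $A$ whose row space is $U$; for $I\in\binom{[n]}{d}$, $\Delta_I(U)$ is the $d\times d$ minor of $A$ with column set $I$ (equal to $1$ if $d=0$), and $\Delta(U)=(\Delta_I(U))_I$, well defined up to a common nonzero scalar. **$k$-adjoint and strata.** For $X\in L_k(\mathcal{A})$, $I\in\binom{[n]}{k}$, let $a_I(X)=(-1)^{\frac12k(k+1)+\sum_{i\in I}i}\Delta_{[n]\setminus I}(X)$ and $H(X)=\{(x_I)_I\in\mathbb{R}^{\binom{[n]}{k}}\mid\sum_I a_I(X)x_I=0\}$. The $k$-adjoint is the arrangement $\mathcal{A}^{(k)}=\{H(X)\mid X\in L_k(\mathcal{A})\}$ in $\mathbb{R}^{\binom{[n]}{k}}$. For $P\in L(\mathcal{A}^{(k)})$, $\mathcal{S}_P=\{U\in\mathrm{Gr}(k,n)\mid\Delta(U)\in P^\circ\}$. **Invariants.** For a linear arrangement $\mathcal{B}$, $\mathfrak{M}(\mathcal{B})$ is the matroid on (an index set of) $\mathcal{B}$ given by linear independence of the normal vectors of the hyperplanes of $\mathcal{B}$; $I_i(\mathcal{B})$ is the number of independent sets of size $i$ of $\mathfrak{M}(\mathcal{B})$; $w_i(\mathcal{B})$ is the $i$-th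 Whitney number of the first kind of $\mathfrak{M}(\mathcal{B})$, i.e. the coefficient in the characteristic polynomial $\chi_{\mathfrak{M}}(t)=\sum_{x\in L(\mathfrak{M})}\mu(\hat0,x)t^{r-\mathrm{rank}(x)}=\sum_{i=0}^{r}w_it^{r-i}$, where $\mathfrak M=\mathfrak M(\mathcal B)$, $r$ is the rank of $\mathfrak{M}$, $L(\mathfrak{M})$ its lattice of flats with minimum $\hat0$, and $\mu$ the Möbius function of $L(\mathfrak{M})$. *)

(* Defs.v *)
From HB Require Import structures.
From mathcomp Require Import all_boot all_order all_algebra.
From mathcomp Require Import finmap.
From mathcomp Require Import reals.
From mathcomp Require classical_sets.

Set Implicit Arguments.
Unset Strict Implicit.
Unset Printing Implicit Defensive.

Import Order.TTheory GRing.Theory Num.Theory.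
Local Open Scope ring_scope.

(* A linear arrangement is a finite set of hyperplanes of a subspace U of an
   ambient space vT; taking U := fullv gives the arrangements in vT itself.
   Linearity (every hyperplane contains 0) is built into {vspace vT}. *)
Section Arrangements.
Variables (F : fieldType) (vT : vectType F).
Implicit Types (U V X Y H : {vspace vT}) (A L : {fset {vspace vT}}).

Definition arrangement_in U A : Prop :=
  forall H, H \in A -> (H <= U)%VS /\ (\dim H).+1 = \dim U.

Definition essential U A : Prop :=
  (U :&: \bigcap_(H <- A) H)%VS = 0%VS.

Definition intersections U A : {fset {vspace vT}} :=
  [fset (U :&: \bigcap_(H <- (B : {fset {vspace vT}})) H)%VS
    | B in fpowerset A]%fset.

(* The order of the intersection lattice is reverse inclusion. *)
Definition lat_le X Y : bool := (Y <= X)%VS.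
Definition lat_lt X Y : bool := lat_le X Y && (X != Y).

Definition in_open L X (v : vT) : bool :=
  (v \in X) && [forall Y : L, lat_lt X (val Y) ==> (v \notin val Y)].

Definition restriction A U : {fset {vspace vT}} :=
  [fset (H :&: U)%VS | H in A & ~~ (U <= H)%VS]%fset.

End Arrangements.

Section Plucker.
Variable R : fieldType.

(* The columns in I are taken in increasing order; this is meaningful only
   when #|I| = d. *)
Definition maxminor (d n : nat) (M : 'M[R]_(d, n)) (I : {set 'I_n}) : R :=
  \det (\matrix_(i < d, j < d) nth 0 [seq M i c | c <- enum I] j).

(* Plücker coordinates for the matrix whose rows are the chosen basis vbasis U;
   another choice multiplies all of them by a common nonzero scalar. *)
Definition plucker n (U : {vspace 'rV[R]_n}) (I : {set 'I_n}) : R :=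
  maxminor (\matrix_(i < \dim U) (vbasis U)`_i) I.

Definition ksubset (n k : nat) : finType := {I : {set 'I_n} | #|I| == k}.

Definition plucker_space (n k : nat) : vectType R :=
  {ffun ksubset n k -> R^o}.

Definition plucker_vec n k (U : {vspace 'rV[R]_n}) : plucker_space n k :=
  [ffun I : ksubset n k => plucker U (val I)].

(* The elements of 'I_n are 0, ..., n - 1, hence the shift i.+1 in the sign. *)
Definition adjoint_coef n (k : nat) (X : {vspace 'rV[R]_n})
    (I : {set 'I_n}) : R :=
  (-1) ^+ ((k * k.+1)./2 + \sum_(i in I) i.+1) * plucker X (~: I).

Definition adjoint_form n k (X : {vspace 'rV[R]_n})
    (x : plucker_space n k) : R^o :=
  \sum_(I : ksubset n k) adjoint_coef k X (val I) * x I.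

Definition adjoint_hyperplane n k (X : {vspace 'rV[R]_n}) :
    {vspace plucker_space n k} :=
  lker (linfun (@adjoint_form n k X)).

Lemma mem_adjoint_hyperplane n k (X : {vspace 'rV[R]_n})
    (x : plucker_space n k) :
  (x \in adjoint_hyperplane k X) =
  (\sum_(I : ksubset n k) adjoint_coef k X (val I) * x I == 0).
Proof.
have lin : linear (@adjoint_form n k X).
  move=> a u v; rewrite /adjoint_form scaler_sumr -big_split /=.
  by apply: eq_bigr => I _; rewrite !ffunE mulrDr /GRing.scale /= mulrCA.
pose f := GRing.isLinear.Build _ _ _ _ (@adjoint_form n k X) lin.
pose g : {linear plucker_space n k -> R^o} :=
  HB.pack (@adjoint_form n k X) f.
by rewrite memv_ker (lfunE g).
Qed.

Definition rank_in n (X : {vspace 'rV[R]_n}) : nat := n - \dim X.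

Definition adjoint n k (A : {fset {vspace 'rV[R]_n}}) :
    {fset {vspace plucker_space n k}} :=
  [fset adjoint_hyperplane k X
    | X in intersections fullv A & rank_in X == k]%fset.

Definition adjoint_lattice n k (A : {fset {vspace 'rV[R]_n}}) :
    {fset {vspace plucker_space n k}} :=
  intersections fullv (adjoint k A).

Definition adjoint_stratum n k (A : {fset {vspace 'rV[R]_n}})
    (P : {vspace plucker_space n k}) : pred {vspace 'rV[R]_n} :=
  fun U => (\dim U == k) && in_open (adjoint_lattice k A) P (plucker_vec k U).

End Plucker.

Section Matroid.
Variables (E : finType) (indep : pred {set E}).
Implicit Types S T : {set E}.

Definition indep_number (i : nat) : nat :=
  #|[set S : {set E} | indep S & #|S| == i]|.

Definition mrank S : nat := \max_(T : {set E} | (T \subset S) && indep T) #|T|.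

Definition mclosure S : {set E} := [set x | mrank (x |: S) == mrank S].

Definition flats : {set {set E}} := [set S | mclosure S == S].

End Matroid.

Section Mobius.
Variables (E : finType) (L : {set {set E}}).
Implicit Types X Y Z : {set E}.

(* The Möbius function of L ordered by inclusion. Strict inclusion decreases
   cardinality, so #|Y| + 1 steps of recursion suffice. *)
Fixpoint mobius_rec (m : nat) X Y : int :=
  if m is m'.+1 then
    if X == Y then 1
    else if X \proper Y then
      - \sum_(Z in L | (X \subset Z) && (Z \proper Y)) mobius_rec m' X Z
    else 0
  else 0.

Definition mobius X Y : int := mobius_rec #|Y|.+1 X Y.

Lemma mobius_recE m X Y : (#|Y| < m)%N -> mobius_rec m X Y = mobius X Y.
Proof.
rewrite /mobius; suff fuel p : (#|Y| < p -> #|Y| < m ->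
    mobius_rec m X Y = mobius_rec p X Y)%N by apply: fuel.
elim: m p Y => [//|m IH] [//|p] Y; rewrite !ltnS => leYp leYm /=.
case: ifP => // _; case: ifP => // _.
congr (- _); apply: eq_bigr => Z /and3P[_ _ /proper_card ltZ].
by apply: IH; apply: leq_trans ltZ _.
Qed.

Lemma mobius_refl X : mobius X X = 1.
Proof. by rewrite /mobius /= eqxx. Qed.

Lemma mobius_proper X Y : X \proper Y ->
  mobius X Y = - \sum_(Z in L | (X \subset Z) && (Z \proper Y)) mobius X Z.
Proof.
move=> XY; rewrite {1}/mobius /=; case: eqP => [eXY|_].
  by move: XY; rewrite eXY properxx.
rewrite XY; congr (- _); apply: eq_bigr => Z /and3P[_ _ /proper_card ltZ].
exact: mobius_recE.
Qed.

End Mobius.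

Section Whitney.
Variables (E : finType) (indep : pred {set E}).

Definition char_poly_matroid : {poly int} :=
  \sum_(S in flats indep)
     mobius (flats indep) (mclosure indep set0) S
       *: 'X^(mrank indep setT - mrank indep S).

Definition whitney (i : nat) : int :=
  if (i <= mrank indep setT)%N
  then char_poly_matroid`_(mrank indep setT - i) else 0.

End Whitney.

Section ArrangementMatroid.
Variables (R : realType) (n : nat).
Implicit Types (U H : {vspace 'rV[R]_n}) (B : {fset {vspace 'rV[R]_n}}).

(* A normal vector, inside U, of a hyperplane H of U. It is determined up to a
   nonzero scalar; xget picks one. *)
Definition normal_vector U H : 'rV[R]_n :=
  classical_sets.xget 0 (fun v : 'rV[R]_n =>
    [/\ v \in U, v != 0 & forall w, w \in H -> v *m w^T = 0]).

Definition arr_indep U B : pred {set B} :=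
  fun S => free [seq normal_vector U (val K) | K <- enum S].

Definition arr_indep_number U B (i : nat) : nat :=
  indep_number (arr_indep U (B := B)) i.

Definition arr_whitney U B (i : nat) : int := whitney (arr_indep U (B := B)) i.

End ArrangementMatroid.

(* Main.v *)
(* A subspace U of dimension k meets an intersection X of rank k nontrivially iff
   its Plücker vector lies on H(X): by Laplace expansion along k rows, the linear
   form defining H(X) evaluates at that vector to the determinant of a basis of U
   stacked on a basis of X. Hence P1 <= P2 says that every X of rank k meeting U1
   also meets U2. Since A is essential, hyperplanes of A with independent traces
   on U2 extend to k hyperplanes with U2-independent traces, i.e. to some X of rank
   k transversal to U2, hence to U1; so their traces on U1 are independent too.
   This gives an injection g from the restriction to U2 into the restriction to U1
   preserving independence, which proves (1). For (2), by Whitney's theorem |w_i|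
   counts the i-sets containing no broken circuit, and g maps such sets to such
   sets when the image of g is ordered compatibly and before its complement. *)
Require Import Defs.
From mathcomp Require Import all_boot all_order all_algebra.
From mathcomp Require Import finmap.
From mathcomp Require Import reals.
From mathcomp Require Import zify.

Set Implicit Arguments.
Unset Strict Implicit.
Unset Printing Implicit Defensive.

Import Order.TTheory GRing.Theory Num.Theory.
Local Open Scope ring_scope.

(** * The linear matroid of a family of vectors: rank, closure and flats *)

Section VectorConfiguration.
Variables (F : fieldType) (vT : vectType F) (E : finType) (v : E -> vT).
Implicit Types S T X : {set E}.

(** Same shape as [arr_indep], so that the matroid of a restriction is an instance by conversion. *)
Definition vindep : pred {set E} := fun S => free [seq v x | x <- enum S].

Definition vspan S : {vspace vT} := <<[seq v x | x <- enum S]>>%VS.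

Lemma vspan0 : vspan set0 = 0%VS.
Proof. by rewrite /vspan enum_set0 span_nil. Qed.

Lemma mem_vspan S x : x \in S -> v x \in vspan S.
Proof. by move=> xS; apply/memv_span/map_f; rewrite mem_enum. Qed.

Lemma vspan_subP S (W : {vspace vT}) :
  reflect {in S, forall x, v x \in W} (vspan S <= W)%VS.
Proof.
apply: (iffP span_subvP) => [sub x xS | sub u].
  by apply/sub/map_f; rewrite mem_enum.
by case/mapP=> x; rewrite mem_enum => /sub xW ->.
Qed.

Lemma vspanS S T : S \subset T -> (vspan S <= vspan T)%VS.
Proof. by move/subsetP=> sST; apply/vspan_subP => x /sST; apply: mem_vspan. Qed.

Lemma perm_enumU1 x S : x \notin S -> perm_eq (enum (x |: S)) (x :: enum S).
Proof.
move=> xS; apply: uniq_perm; rewrite /= ?mem_enum ?xS ?enum_uniq // => y.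
by rewrite !(inE, mem_enum).
Qed.

Lemma vindepU1 x S : x \notin S ->
  vindep (x |: S) = (v x \notin vspan S) && vindep S.
Proof.
by move/perm_enumU1/(perm_map v)/perm_free=> eq_f; rewrite /vindep eq_f free_cons.
Qed.

Lemma dim_vspan S : vindep S -> \dim (vspan S) = #|S|.
Proof. by move/eqP; rewrite size_map -cardE. Qed.

Lemma vindep0 : vindep set0.
Proof. by rewrite /vindep enum_set0 nil_free. Qed.

Lemma vindep1 x : vindep [set x] = (v x != 0).
Proof. by rewrite -[[set x]]setU0 vindepU1 ?inE // vspan0 memv0 vindep0 andbT. Qed.

(** A largest independent subset of [S] spans: any [v x] outside its span could be added to it. *)
Lemma mrankE S : mrank vindep S = \dim (vspan S).
Proof.
apply/eqP; rewrite eqn_leq; apply/andP; split.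
  apply/bigmax_leqP => T /andP[sTS /dim_vspan <-].
  exact: dimvS (vspanS sTS).
have base : (set0 \subset S) && vindep set0 by rewrite sub0set vindep0.
have [T /andP[sTS fT] maxT] :=
  @arg_maxnP _ set0 (fun T => (T \subset S) && vindep T) (fun T => #|T|) base.
apply: (@leq_trans #|T|); last first.
  by apply: (@leq_bigmax_cond _ _ (fun T : {set E} => #|T|)); rewrite sTS.
rewrite -(dim_vspan fT); apply/dimvS/vspan_subP => x xS.
have [/mem_vspan // | xT] := boolP (x \in T).
apply: contraT => vxT; have := maxT (x |: T).
rewrite subUset sub1set xS sTS vindepU1 // vxT fT /= => /(_ isT).
by rewrite cardsU1 xT ltnn.
Qed.

Lemma mclosureE S : mclosure vindep S = [set x | v x \in vspan S].
Proof.
apply/setP => x; rewrite !inE !mrankE.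
have sub : (vspan S <= vspan (x |: S))%VS by apply/vspanS/subsetUr.
rewrite eq_sym dimv_leqif_eq //; apply/eqP/idP => [-> | vx].
  by apply/mem_vspan/setU11.
apply/eqP; rewrite eqEsubv sub; apply/vspan_subP => y /setU1P[->//|].
exact: mem_vspan.
Qed.

(** Used to sort the subsets of a flat by their closure. *)
Lemma mclosure_sub S X : X \in flats vindep ->
  (mclosure vindep S \subset X) = (S \subset X).
Proof.
rewrite inE => /eqP flX; apply/subsetP/subsetP => sub x xS.
  by apply: sub; rewrite mclosureE inE mem_vspan.
have /vspanS/subvP sSX : S \subset X by apply/subsetP.
by rewrite -flX mclosureE inE sSX //; move: xS; rewrite mclosureE inE.
Qed.

Lemma vspan_mclosure S : vspan (mclosure vindep S) = vspan S.
Proof.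
apply/eqP; rewrite eqEsubv; apply/andP; split.
  by apply/vspan_subP => x; rewrite mclosureE inE.
by apply/vspanS/subsetP => x xS; rewrite mclosureE inE mem_vspan.
Qed.

Lemma mclosure_flat S : mclosure vindep S \in flats vindep.
Proof. by rewrite inE [mclosure _ (mclosure _ _)]mclosureE vspan_mclosure -mclosureE. Qed.

(** * Whitney's broken circuit theorem *)

Section BrokenCircuits.
Variable f : E -> nat.
Hypothesis f_inj : injective f.
Hypothesis v_neq0 : forall x, v x != 0.

Definition above c S := [set s in S | (f c < f s)%N].

(* Minimal dependent sets are not mentioned: [S] contains a circuit deprived of
   its least element [c] iff [c] lies in the closure of the part of [S] above [c]. *)
Definition nbc S := [forall c, v c \notin vspan (above c S)].

Lemma nbcP S : reflect (forall c, v c \notin vspan (above c S)) (nbc S).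
Proof. exact: forallP. Qed.

Lemma aboveS c S T : S \subset T -> above c S \subset above c T.
Proof.
by move=> /subsetP sST; apply/subsetP => x; rewrite !inE => /andP[/sST-> ->].
Qed.

Lemma nbcS S T : S \subset T -> nbc T -> nbc S.
Proof.
move=> sST /nbcP nT; apply/nbcP => c; apply: contra (nT c).
by apply/subvP/vspanS/aboveS.
Qed.

Lemma nbc0 : nbc set0.
Proof.
apply/nbcP => c; suff -> : above c set0 = set0 by rewrite vspan0 memv0.
by apply/setP => x; rewrite !inE.
Qed.

(** Induction on the size: for the least element [e] of [S], the set [above e S] is all of [S :\ e],
    so the condition at [e] keeps [v e] out of the span of the rest. *)
Lemma nbc_indep S : nbc S -> vindep S.
Proof.
have [m] := ubnP #|S|; elim: m S => // m IH S; rewrite ltnS => leSm nS.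
have [->|/set0Pn[x0 x0S]] := eqVneq S set0; first exact: vindep0.
have [e eS mine] := @arg_minnP _ x0 (fun x => x \in S) f x0S.
have defS : S = e |: (S :\ e) by rewrite setD1K.
have ind : vindep (S :\ e).
  apply: IH; last exact: nbcS (subD1set _ _) nS.
  by apply: leq_trans leSm; rewrite [X in (_ < X)%N](cardsD1 e) eS.
rewrite defS vindepU1 ?setD11 // ind andbT.
move/nbcP: nS => /(_ e); congr (v e \notin vspan _).
apply/setP => x; rewrite !inE andbC; have [xS|] := boolP (x \in S);
  last by rewrite !andbF.
by rewrite !andbT ltn_neqAle (mine x xS) andbT eq_sym (inj_eq f_inj).
Qed.

(* The least element [e] of a flat can be added to or removed from any nbc set
   it contains, which gives a sign-reversing involution. *)
Lemma nbcU1_min X e S : X \in flats vindep -> e \in X ->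
    {in X, forall x, (f e <= f x)%N} -> S \subset X -> nbc S -> nbc (e |: S).
Proof.
rewrite inE => /eqP flX eX mine sSX nS; apply/nbcP => c.
have [lt_ce | le_ec] := ltnP (f c) (f e).
  apply: contraL lt_ce => vc; rewrite -leqNgt mine // -flX mclosureE inE.
  apply: subvP vc; apply/vspanS/subsetP => x; rewrite !inE => /andP[+ _].
  by case/predU1P=> [->//|]; apply/subsetP.
have -> : above c (e |: S) = above c S; last exact/nbcP.
apply/setP => x; rewrite !inE; case: eqVneq => //= ->.
by rewrite ltnNge le_ec andbF.
Qed.

Lemma sum_nbc_flat X : X \in flats vindep -> X != set0 ->
  \sum_(S : {set E} | nbc S && (S \subset X)) (-1) ^+ #|S| = 0 :> int.
Proof.
move=> flX /set0Pn[x0 x0X].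
have [e eX mine] := @arg_minnP _ x0 (fun x => x \in X) f x0X.
rewrite (bigID (fun S : {set E} => e \in S)) /=.
(* The sets containing [e] are [e |: S] with [e] not in [S]; adding [e] flips the sign. *)
rewrite (reindex_onto (fun S => e |: S) (fun S => S :\ e)) /=; last first.
  by move=> S /andP[_ eS]; rewrite setD1K.
apply/eqP; rewrite addr_eq0 -sumrN; apply/eqP.
rewrite [RHS](eq_bigl (fun S => nbc S && (S \subset X) && (e \notin S))) //.
apply: eq_big => [S | S /andP[_ /eqP eS]]; last first.
  by rewrite cardsU1 -{1}eS setD11 exprS mulN1r.
have [eS | eS] := boolP (e \in S).
  rewrite setU11 /= !andbF; apply/negbTE/nandP; right.
  by apply: contraTneq eS => <-; rewrite setD11.
rewrite setU11 setU1K // eqxx !andbT subUset sub1set eX /=.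
have [sSX | _] := boolP (S \subset X); rewrite ?andbF // !andbT.
by apply/idP/idP => [/(nbcS (subsetUr _ _)) | /(nbcU1_min flX eX mine sSX)].
Qed.

Lemma mclosure0 : mclosure vindep set0 = set0.
Proof.
apply/setP => x; rewrite mclosureE vspan0 !inE memv0.
exact/negbTE/v_neq0.
Qed.

(** Both sides satisfy the recursion of the Möbius function: by [sum_nbc_flat] the signed count of
    nbc subsets of a nonempty flat vanishes, and sorting these subsets by closure turns it into a
    sum over the flats below. *)
Lemma mobius_nbc X : X \in flats vindep ->
  mobius (flats vindep) set0 X
    = \sum_(S : {set E} | nbc S && (mclosure vindep S == X)) (-1) ^+ #|S|.
Proof.
have [m] := ubnP #|X|; elim: m X => // m IH X; rewrite ltnS => leXm flX.
have [-> | X0] := eqVneq X set0.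
  rewrite mobius_refl (big_pred1 set0) ?cards0 // => S /=.
  apply/andP/eqP => [[_ /eqP S0] | ->]; last by rewrite nbc0 mclosure0.
  apply/eqP; rewrite -subset0 -S0; apply/subsetP => x xS.
  by rewrite mclosureE inE mem_vspan.
have X0' : set0 \proper X by rewrite properEneq sub0set eq_sym X0.
rewrite (mobius_proper _ X0'); have /eqP := sum_nbc_flat flX X0.
rewrite (bigID (fun S => mclosure vindep S == X)) /= addr_eq0 => /eqP sum0.
transitivity (- \sum_(S : {set E} | nbc S && (S \subset X)
    && (mclosure vindep S != X)) (-1) ^+ #|S| : int); last first.
  rewrite -sum0; apply: eq_bigl => S; have [<-|_] := eqVneq; rewrite ?andbF //.
  by rewrite !andbT -mclosure_sub ?mclosure_flat // subxx andbT.
congr (- _); rewrite [RHS](partition_big (mclosure vindep)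
  (fun Z => (Z \in flats vindep) && ((set0 \subset Z) && (Z \proper X)))) /=.
  apply: eq_bigr => Z /and3P[flZ _ ltZX].
  rewrite IH ?(leq_trans (proper_card ltZX)) //; apply: eq_bigl => S.
  have [eZ|_] := eqVneq; rewrite ?andbF // !andbT.
  rewrite -mclosure_sub // eZ proper_sub //=.
  by move: ltZX; rewrite properEneq => /andP[-> _]; rewrite !andbT.
move=> S /andP[/andP[_ sSX] neX]; rewrite mclosure_flat sub0set.
by rewrite properEneq neX mclosure_sub.
Qed.

(** An nbc set is independent, so its size is the rank of its closure; hence the flats of rank [i]
    collect exactly the nbc sets of size [i]. *)
Lemma whitney_nbc i :
  whitney vindep i = (-1) ^+ i * #|[set S | nbc S & #|S| == i]|%:R.
Proof.
have rank_nbc S : nbc S -> mrank vindep (mclosure vindep S) = #|S|.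
  by move=> /nbc_indep/dim_vspan; rewrite mrankE vspan_mclosure.
have le_rank S : (mrank vindep S <= mrank vindep setT)%N.
  by rewrite !mrankE; apply/dimvS/vspanS/subsetT.
(* Above the rank, [whitney] is 0 by convention and no nbc set is large enough. *)
rewrite /whitney; case: leqP => [le_i | lt_i]; last first.
  rewrite (_ : [set _ | _ & _] = set0) ?cards0 ?mulr0 //.
  apply/setP => S; rewrite !inE; apply/negP => /andP[nS /eqP eqi].
  by move: lt_i; rewrite -eqi -(rank_nbc _ nS) ltnNge le_rank.
rewrite /char_poly_matroid coef_sum mclosure0.
transitivity (\sum_(X in flats vindep | mrank vindep X == i)
    mobius (flats vindep) set0 X).
  rewrite [RHS]big_mkcondr; apply: eq_bigr => X flX.
  rewrite coefZ coefXn; have [<-|neq] := eqVneq (mrank vindep X) i;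
    first by rewrite eqxx mulr1.
  (* Ranks are bounded by the total rank, so the truncated subtraction is injective on them. *)
  rewrite (_ : (_ == _) = false) ?mulr0 //; apply: contraNF neq => /eqP eq_sub.
  by rewrite -(subKn (le_rank X)) -eq_sub subKn.
under eq_bigr => X /andP[flX _] do rewrite mobius_nbc //.
rewrite -sum1_card natr_sum mulr_sumr.
rewrite [RHS](partition_big (mclosure vindep)
  (fun X => (X \in flats vindep) && (mrank vindep X == i))) /=; last first.
  by move=> S; rewrite inE mclosure_flat => /andP[/rank_nbc->].
apply: eq_bigr => X /andP[_ /eqP rkX]; apply: eq_big => [S | S].
  rewrite inE; have [nS /=|//] := boolP (nbc S).
  by case: eqVneq => [eX|]; rewrite ?andbF // -rkX -eX rank_nbc // eqxx.
by case/andP=> nS /eqP eX; rewrite mulr1 -rkX -eX rank_nbc.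
Qed.

End BrokenCircuits.
End VectorConfiguration.

(** * Comparison of two configurations along an independence-preserving injection *)

Section WeakMap.
Variables (F : fieldType) (vT1 vT2 : vectType F) (E1 E2 : finType).
Variables (v1 : E1 -> vT1) (v2 : E2 -> vT2) (g : E2 -> E1).
Hypotheses (v1_neq0 : forall x, v1 x != 0) (v2_neq0 : forall x, v2 x != 0).
Hypothesis g_inj : injective g.
Hypothesis g_indep : forall S, vindep v2 S -> vindep v1 (g @: S).

Lemma weak_map_indep_number i :
  (indep_number (vindep v2) i <= indep_number (vindep v1) i)%N.
Proof.
rewrite /indep_number -(card_imset _ (imset_inj g_inj)); apply/subset_leq_card.
apply/subsetP => _ /imsetP[S + ->]; rewrite !inE => /andP[iS].
by rewrite g_indep // card_imset.
Qed.

(* Elements outside the image of [g] come last, so that a broken circuit of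
   [v1] inside the image arises from a circuit inside the image. *)
Definition weak_map_order (y : E1) : nat :=
  if [pick x | g x == y] is Some x then enum_rank x
  else #|E2| + enum_rank y.

Lemma weak_map_order_img x : weak_map_order (g x) = enum_rank x.
Proof.
rewrite /weak_map_order; case: pickP => [x' /eqP/g_inj -> //|/(_ x)].
by rewrite eqxx.
Qed.

Lemma weak_map_order_out y : y \notin codom g ->
  weak_map_order y = (#|E2| + enum_rank y)%N.
Proof.
rewrite /weak_map_order; case: pickP => // x /eqP <-.
by rewrite codom_f.
Qed.

Lemma weak_map_order_inj : injective weak_map_order.
Proof.
have ltE2 (x : E2) : (enum_rank x < #|E2|)%N by apply: ltn_ord.
have out x y : y \notin codom g -> weak_map_order (g x) <> weak_map_order y.
  move=> /weak_map_order_out ->; rewrite weak_map_order_img => eq_xy.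
  by have := ltE2 x; rewrite eq_xy ltnNge leq_addr.
move=> y y'; have [/codomP[x ->] | yg] := boolP (y \in codom g);
    have [/codomP[x' ->] | y'g] := boolP (y' \in codom g).
- by rewrite !weak_map_order_img => /val_inj/enum_rank_inj ->.
- by move/out; case.
- by move/esym/out; case.
- by rewrite !weak_map_order_out // => /addnI/val_inj/enum_rank_inj.
Qed.

Let rank2 (x : E2) : nat := enum_rank x.

Lemma rank2_inj : injective rank2.
Proof. by move=> x y /val_inj/enum_rank_inj. Qed.

(** For [y] outside the image, nothing of [g @: S] lies above [y]. For [y = g x], the part above is
    the image of [above rank2 x S], which stays independent after adding [x]; [g] preserves this. *)
Lemma weak_map_nbc S : nbc v2 rank2 S -> nbc v1 weak_map_order (g @: S).
Proof.
move=> nS; apply/forallP => y.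
have [/codomP[x ->] | yg] := boolP (y \in codom g); last first.
  rewrite (_ : above _ _ _ = set0) ?vspan0 ?memv0 //.
  apply/setP => z; rewrite !inE; apply/negP => /andP[/imsetP[x _ ->]].
  rewrite weak_map_order_img weak_map_order_out // ltnNge => /negP[].
  by apply: leq_trans (leq_addr _ _); apply/ltnW/ltn_ord.
have aboveE : above weak_map_order (g x) (g @: S) = g @: above rank2 x S.
  apply/setP => z; rewrite inE; apply/andP/imsetP => [[/imsetP[s sS ->]]|[s + ->]].
    by rewrite !weak_map_order_img => lt; exists s; rewrite // inE sS.
  by rewrite inE => /andP[sS lt]; rewrite imset_f // !weak_map_order_img.
have xa : x \notin above rank2 x S by rewrite inE ltnn andbF.
have : vindep v2 (x |: above rank2 x S).
  rewrite vindepU1 // (forallP nS) (nbc_indep rank2_inj) //.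
  by apply: nbcS nS; apply/subsetP => z; rewrite inE => /andP[].
move/g_indep; rewrite imsetU1 vindepU1 ?mem_imset //.
by rewrite aboveE => /andP[].
Qed.

(** [whitney_nbc] holds for every injective order, so each side may be counted with its own. *)
Lemma weak_map_whitney i :
  `|whitney (vindep v2) i| <= `|whitney (vindep v1) i|.
Proof.
rewrite (whitney_nbc rank2_inj) // (whitney_nbc weak_map_order_inj) //.
rewrite !normrM !normrX !normrN1 !expr1n !mul1r !normr_nat ler_nat.
rewrite -(card_imset _ (imset_inj g_inj)); apply/subset_leq_card.
apply/subsetP => _ /imsetP[S + ->]; rewrite !inE => /andP[nS].
by rewrite weak_map_nbc // card_imset.
Qed.

End WeakMap.

(** * Laplace expansion of a determinant along its first k rows *)

Section LaplaceExpansion.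

Lemma sorted_enum_ord n (I : {set 'I_n}) : sorted ltn [seq val i | i <- enum I].
Proof.
apply: (subseq_sorted ltn_trans _ (iota_ltn_sorted 0 n)).
by rewrite -val_enum_ord enumT; apply/map_subseq/filter_subseq.
Qed.

(** Both lists are strictly increasing with the same elements, as [lift j] is increasing. *)
Lemma enum_imset_lift n (j : 'I_n.+1) (J : {set 'I_n}) :
  enum (lift j @: J) = map (lift j) (enum J).
Proof.
apply: (inj_map val_inj); apply: (irr_sorted_eq ltn_trans ltnn).
- exact: sorted_enum_ord.
- have /= mono : {homo bump j : x y / (x < y)%N}.
    by move=> x y; rewrite /bump; lia.
  rewrite -map_comp (map_comp (bump j) val).
  exact: (homo_sorted mono) (sorted_enum_ord J).
have eq_mem : enum (lift j @: J) =i map (lift j) (enum J).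
  move=> x; rewrite mem_enum; apply/imsetP/mapP => [[y yJ ->]|[y yJ ->]].
    by exists y; rewrite ?mem_enum.
  by exists y; rewrite // -mem_enum.
exact: eq_mem_map.
Qed.

Lemma index_sorted_ltn (s : seq nat) x : sorted ltn s -> x \in s ->
  index x s = count (ltn^~ x) s.
Proof.
elim: s => //= y s IH sorted_s; rewrite inE.
have lt_y : all (ltn y) s by apply: order_path_min sorted_s; apply: ltn_trans.
have [eq_yx _ | neq] := eqVneq y x.
  rewrite -eq_yx ltnn; apply/esym/eqP; rewrite -leqn0 leqNgt -has_count -all_predC.
  by apply: sub_all lt_y => z lt_yz /=; rewrite -leqNgt ltnW.
rewrite /= => xs.
by rewrite (allP lt_y : forall z, z \in s -> (y < z)%N) // IH // (path_sorted sorted_s).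
Qed.

Lemma index_enum_ord n (I : {set 'I_n}) j : j \in I ->
  index j (enum I) = #|[set i in I | (i < j)%N]|.
Proof.
move=> jI; rewrite -(index_map val_inj) index_sorted_ltn ?sorted_enum_ord //; last first.
  by apply: map_f; rewrite mem_enum.
rewrite count_map cardE -size_filter /enum_mem -filter_predI.
by congr (size _); apply: eq_filter => i; rewrite /= !inE andbC.
Qed.

(** Lifting raises by one the elements of [J] that are at least [j], and the index of [j] counts
    those below [j]; together every element of [J] contributes one. *)
Lemma sum_lift_sign n (j : 'I_n.+1) (J : {set 'I_n}) :
  (\sum_(i in j |: lift j @: J) i + index j (enum (j |: lift j @: J))
    = j + \sum_(i in J) i + #|J|)%N.
Proof.
have jJ : j \notin lift j @: J.
  by apply/imsetP => -[i _ /eqP]; rewrite eq_liftF.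
rewrite index_enum_ord ?setU11 // big_setU1 //= big_imset /=; last first.
  by move=> x y _ _; apply: lift_inj.
rewrite -!addnA; congr (_ + _)%N; rewrite /bump big_split /= addnAC addnC.
congr (_ + _)%N.
have -> : [set i in j |: lift j @: J | (i < j)%N]
    = lift j @: [set i in J | (i < j)%N].
  apply/setP => i; rewrite !inE; apply/andP/imsetP.
    case=> /predU1P[->|/imsetP[x xJ ->]]; first by rewrite ltnn.
    by move=> /= lt; exists x; rewrite // inE xJ; move: lt; rewrite /bump; lia.
  case=> x; rewrite inE => /andP[xJ lt] ->; rewrite imset_f // orbT.
  by move: lt; rewrite /= /bump; lia.
rewrite card_imset; last exact: lift_inj.
rewrite -!sum1_card [X in (_ + X)%N](eq_bigl (fun i => (i \in J) && (i < j)%N)) => [|i];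
  last by rewrite inE.
by rewrite big_mkcondr -big_split /=; apply: eq_bigr => i _; case: leqP.
Qed.

Section Minors.
Variable R : fieldType.

Lemma maxminor_col' d n (M : 'M[R]_(d, n.+1)) j (J : {set 'I_n}) :
  maxminor (col' j M) J = maxminor M (lift j @: J).
Proof.
congr (\det _); apply/matrixP => i p; rewrite !mxE enum_imset_lift -map_comp.
by congr (nth _ _ _); apply: eq_map => c; rewrite /= mxE.
Qed.

(** In [maxminor_row0] this matches the removal of a column from [I] with the index shift in a
    cofactor. *)
Lemma nth_rem (T : eqType) (x0 : T) s p q : uniq s -> (p < size s)%N ->
  nth x0 (rem (nth x0 s p) s) q = nth x0 s (bump p q).
Proof.
move=> us lt_ps; rewrite remE index_uniq // nth_cat (size_takel (ltnW lt_ps)) /bump.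
case: leqP => [le_pq | lt_qp]; last by rewrite add0n nth_take.
by rewrite nth_drop add1n addSn subnKC.
Qed.

Lemma maxminor_row0 d n (M : 'M[R]_(d.+1, n)) (I : {set 'I_n}) : #|I| = d.+1 ->
  maxminor M I = \sum_(j in I)
    (-1) ^+ index j (enum I) * M ord0 j * maxminor (row' ord0 M) (I :\ j).
Proof.
move=> cardI; have size_enum : size (enum I) = d.+1 by rewrite -cardE.
have [x0 _] : exists x0, x0 \in I by apply/card_gt0P; rewrite cardI.
rewrite -big_enum /= (big_nth x0) size_enum big_mkord /maxminor.
rewrite (expand_det_row _ ord0); apply: eq_bigr => p _.
set x := nth x0 _ p.
have lt_p : (p < size (enum I))%N by rewrite size_enum.
rewrite mxE (nth_map x0) // index_uniq ?enum_uniq // /cofactor add0n.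
rewrite mulrA [M _ _ * _]mulrC; congr (_ * \det _); apply/matrixP => i q.
rewrite !mxE.
have enumD1 : enum (I :\ x) = rem x (enum I).
  rewrite rem_filter ?enum_uniq // /enum_mem -filter_predI.
  by apply: eq_filter => y; rewrite /= !inE.
have lt_q : (bump p q < size (enum I))%N by rewrite size_enum; apply: ltn_ord (lift p q).
rewrite enumD1 (nth_map x0) // (nth_map x0); last first.
  by rewrite size_rem ?mem_nth // size_enum.
by rewrite mxE nth_rem ?enum_uniq.
Qed.

(* The indices in [I] start from 0, whence [k (k - 1) / 2] in the sign. *)
Lemma det_laplace k m n (e : (k + m)%N = n) (A : 'M[R]_(k, n)) (B : 'M_(m, n)) :
  \det (castmx (e, erefl n) (col_mx A B)) = \sum_(I : {set 'I_n} | #|I| == k)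
    (-1) ^+ ('C(k, 2) + \sum_(i in I) i) * maxminor A I * maxminor B (~: I).
Proof.
elim: k n e A B => [|k IH] n e A B.
  (* Only the empty set remains: its minor of [A] is an empty determinant, equal to 1, and the minor
     of [B] is the whole determinant. *)
  rewrite (big_pred1 set0) => [|I]; last by rewrite cards_eq0.
  case: n / e A B => A B.
  rewrite big_set0 setC0 /maxminor det_mx00 !mul1r; congr (\det _).
  apply/matrixP => i j.
  rewrite castmxE /= (_ : cast_ord _ i = rshift 0 i) ?col_mxEd; last exact/val_inj.
  have enumT : enum [set: 'I_(0 + m)] = enum 'I_m.
    by apply: eq_enum => x; rewrite inE.
  rewrite enumT mxE (nth_map j) ?size_enum_ord ?nth_ord_enum ?ltn_ord // cast_ord_id.
  by congr (B _ j); apply: val_inj.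
case: n e A B => // n e A B; have e' : (k + m)%N = n by case: e.
rewrite (expand_det_row _ ord0).
pose t (j : 'I_n.+1) (I : {set 'I_n.+1}) : R :=
  (-1) ^+ ('C(k.+1, 2) + \sum_(i in I) i) * ((-1) ^+ index j (enum I)
     * A ord0 j * maxminor (row' ord0 A) (I :\ j)) * maxminor B (~: I).
transitivity (\sum_(I : {set 'I_n.+1} | #|I| == k.+1) \sum_(j in I) t j I);
    last first.
  apply: eq_bigr => I /eqP cardI; rewrite (maxminor_row0 A cardI).
  by rewrite mulr_sumr mulr_suml.
rewrite (exchange_big_dep xpredT) //=; apply: eq_bigr => j _.
(* A set containing [j] is uniquely [j |: lift j @: J], with [J] indexing the columns left after
   deleting column [j]. *)
rewrite (reindex_onto (fun J : {set 'I_n} => j |: lift j @: J)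
   (fun I => lift j @^-1: I)) /=; last first.
  move=> I /andP[_ jI]; apply/setP => i; rewrite !inE.
  case: (unliftP j i) => [i'|] -> ; last by rewrite eqxx jI.
  rewrite eq_sym (negbTE (neq_lift _ _)) /=.
  by rewrite mem_imset ?inE //; apply: lift_inj.
have liftE (J : {set 'I_n}) : j \notin lift j @: J.
  by apply/imsetP => -[i _ /eqP]; rewrite eq_liftF.
rewrite [RHS](eq_bigl (fun J : {set 'I_n} => #|J| == k)) => [|J]; last first.
  rewrite cardsU1 liftE card_imset ?eqSS; last exact: lift_inj.
  rewrite setU11 andbT [X in _ && X](_ : _ = true) ?andbT //.
  apply/eqP/setP => i; rewrite !inE eq_sym (negbTE (neq_lift _ _)) /=.
  by rewrite mem_imset //; apply: lift_inj.
rewrite /cofactor.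
have -> : row' ord0 (col' j (castmx (e, erefl n.+1) (col_mx A B)))
    = castmx (e', erefl n) (col_mx (row' ord0 (col' j A)) (col' j B)).
  apply/matrixP => i i'; rewrite castmxE cast_ord_id 2!mxE castmxE cast_ord_id /=.
  rewrite !mxE; case: splitP => p /= eq_p; case: splitP => q /= eq_q;
    rewrite ?mxE; try by move: (ltn_ord p) (ltn_ord q); rewrite /bump in eq_p *; lia.
    congr (A _ _); apply: val_inj => /=; rewrite /bump in eq_p *; lia.
  congr (B _ _); apply: val_inj => /=; rewrite /bump in eq_p; lia.
rewrite (IH _ e') !mulr_sumr; apply: eq_bigr => J /eqP cardJ; rewrite /t.
have -> : maxminor (row' ord0 (col' j A)) J
    = maxminor (row' ord0 A) ((j |: lift j @: J) :\ j).
  rewrite setU1K // -maxminor_col'; congr maxminor.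
  by apply/matrixP => i i'; rewrite !mxE.
rewrite maxminor_col'; have -> : lift j @: (~: J) = ~: (j |: lift j @: J).
  apply/setP => i; rewrite !inE; case: (unliftP j i) => [i'|] ->.
    rewrite eq_sym (negbTE (neq_lift _ _)) /= !mem_imset ?inE //; exact: lift_inj.
  by rewrite eqxx (negbTE (liftE _)).
have -> : castmx (e, erefl n.+1) (col_mx A B) ord0 j = A ord0 j.
  rewrite castmxE cast_ord_id /= (_ : cast_ord _ _ = lshift m ord0) ?col_mxEu //.
  exact: val_inj.
(* Mod 2 the term [#|J|], equal to k, cancels the increment from ['C(k, 2)] to ['C(k.+1, 2)]. *)
have sign : (-1) ^+ ('C(k.+1, 2) + \sum_(i in j |: lift j @: J) i)
      * (-1) ^+ index j (enum (j |: lift j @: J))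
    = (-1) ^+ (0 + j) * (-1) ^+ ('C(k, 2) + \sum_(i in J) i) :> R.
  rewrite -!exprD -addnA sum_lift_sign cardJ binS bin1 add0n.
  rewrite -[LHS]signr_odd -[RHS]signr_odd; congr (_ ^+ (nat_of_bool _)).
  by rewrite !oddD; case: (odd k); case: (odd j); case: (odd 'C(k, 2));
    case: (odd (\sum_(i in J) i)).
by rewrite !mulrA sign; congr (_ * _ * _); rewrite -mulrA mulrC.
Qed.

End Minors.
End LaplaceExpansion.

(** * Plücker coordinates and transversality *)

Section PluckerIncidence.
Variables (R : fieldType) (n : nat).
Implicit Types U X : {vspace 'rV[R]_n}.

(** The matrix inside [plucker], so [plucker U I] unfolds to a minor of it. *)
Definition basis_mx U : 'M[R]_(\dim U, n) := \matrix_(i < \dim U) (vbasis U)`_i.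

Lemma mul_basis_mx U (a : 'rV_(\dim U)) :
  a *m basis_mx U = \sum_i a 0 i *: (vbasis U)`_i.
Proof. by rewrite mulmx_sum_row; apply: eq_bigr => i _; rewrite rowK. Qed.

Lemma mul_basis_mx_mem U (a : 'rV_(\dim U)) : a *m basis_mx U \in U.
Proof.
rewrite mul_basis_mx; apply: rpred_sum => i _; apply/rpredZ/vbasis_mem.
by rewrite mem_nth ?size_tuple.
Qed.

Lemma mem_basis_mx U w : w \in U -> exists a : 'rV_(\dim U), w = a *m basis_mx U.
Proof.
move=> /coord_vbasis wU; exists (\row_i coord (vbasis U) i w).
by rewrite mul_basis_mx {1}wU; apply: eq_bigr => i _; rewrite mxE.
Qed.

Lemma mul_basis_mx_eq0 U (a : 'rV_(\dim U)) : a *m basis_mx U = 0 -> a = 0.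
Proof.
rewrite mul_basis_mx => /(freeP (basis_free (vbasisP U))) a0.
by apply/rowP => i; rewrite a0 mxE.
Qed.

(** A linear relation among the stacked rows is an equality between a vector of [U] and a vector of
    [X]. *)
Lemma det_basis_mx_eq0 U X (e : (\dim U + \dim X)%N = n) :
  (\det (castmx (e, erefl n) (col_mx (basis_mx U) (basis_mx X))) == 0)
    = (U :&: X != 0)%VS.
Proof.
apply: negb_inj; rewrite negbK -unitfE -unitmxE -row_free_unit row_free_castmx.
apply/idP/eqP => [free_UX | cap0].
  apply/eqP; rewrite -subv0; apply/subvP => w; rewrite memv_cap memv0.
  case/andP=> /mem_basis_mx[a wa] /mem_basis_mx[b wb].
  have : row_mx a (- b) *m col_mx (basis_mx U) (basis_mx X) == 0.
    by rewrite mul_row_col mulNmx -wa -wb subrr.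
  by rewrite mulmx_free_eq0 // row_mx_eq0 wa => /andP[/eqP-> _]; rewrite mul0mx.
apply: inj_row_free => u; rewrite -[u]hsubmxK mul_row_col => /eqP.
rewrite addr_eq0 => /eqP eq_w.
have w0 : lsubmx u *m basis_mx U = 0.
  apply/eqP; rewrite -memv0 -cap0 memv_cap mul_basis_mx_mem eq_w rpredN.
  exact: mul_basis_mx_mem.
rewrite (mul_basis_mx_eq0 w0) (_ : rsubmx u = 0) ?row_mx0 //.
by apply: mul_basis_mx_eq0; apply/eqP; rewrite -oppr_eq0 -eq_w w0.
Qed.

Lemma mem_adjoint_hyperplane_cap U X : (\dim U + \dim X)%N = n ->
  (plucker_vec (\dim U) U \in adjoint_hyperplane (\dim U) X) = (U :&: X != 0)%VS.
Proof.
move=> e; rewrite mem_adjoint_hyperplane -(det_basis_mx_eq0 e) det_laplace.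
set k := \dim U; congr (_ == 0).
rewrite [RHS](big_sub (fun I : {set 'I_n} => #|I| == k)); apply: eq_bigr => I _.
rewrite ffunE /adjoint_coef mulrAC; congr (_ * _ * _).
(* Counting indices from 1 adds k to the sum, and k(k+1)/2 exceeds ['C(k, 2)] by k, so the exponents
   differ by 2k. *)
rewrite -[LHS]signr_odd -[RHS]signr_odd; congr (_ ^+ (nat_of_bool _)).
have -> : (\sum_(i in val I) i.+1 = \sum_(i in val I) i + k)%N.
  under eq_bigr => i _ do rewrite -addn1.
  by rewrite big_split /= sum1_card (eqP (valP I)).
have -> : (k * k.+1)./2 = ('C(k, 2) + k)%N by rewrite mulnC -bin2 binS bin1.
by rewrite !oddD; case: (odd k); case: (odd 'C(k, 2)); case: (odd (\sum_(i in val I) i)).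
Qed.

End PluckerIncidence.

(** * Orthogonal complements and normal vectors *)

Section Orthogonal.
Variables (R : realType) (n : nat).
Implicit Types (U W H K : {vspace 'rV[R]_n}) (v w : 'rV[R]_n).

(** A real sum of squares vanishes only termwise; hence [orthov W] meets [W] trivially. *)
Lemma dotmx_eq0 v : (v *m v^T == 0) = (v == 0).
Proof.
apply/eqP/eqP => [/matrixP/(_ 0 0) | ->]; last by rewrite mul0mx.
rewrite !mxE => /eqP; rewrite psumr_eq0 => [/allP v0 | i _]; last first.
  by rewrite mxE -expr2 sqr_ge0.
apply/rowP => i; have /implyP := v0 i (mem_index_enum i).
by rewrite mxE -expr2 sqrf_eq0 mxE => /(_ isT)/eqP.
Qed.

Lemma dotmxC v w : (v *m w^T == 0) = (w *m v^T == 0).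
Proof. by rewrite -[v in LHS]trmxK -trmx_mul trmx_eq0. Qed.

(** A kernel, so that rank-nullity bounds its dimension from below. *)
Definition orthov W : {vspace 'rV[R]_n} :=
  lker (linfun (mulmxr (basis_mx W)^T : 'rV[R]_n -> 'rV[R]_(\dim W))).

Lemma orthovP W w :
  reflect (forall v, v \in W -> v *m w^T = 0) (w \in orthov W).
Proof.
rewrite memv_ker lfunE /=; apply: (iffP eqP) => [wW v | wW].
  case/mem_basis_mx => a ->; apply: trmx_inj.
  by rewrite !trmx_mul trmxK mulmxA wW mul0mx trmx0.
apply: trmx_inj; rewrite trmx_mul trmxK trmx0; apply/row_matrixP => i.
by rewrite row_mul row0 wW // rowK vbasis_mem // mem_nth ?size_tuple.
Qed.

(** Disjointness from [W] gives one inequality; rank-nullity, for a map into a space of dimension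
    [\dim W], gives the other. *)
Lemma dim_cap_orthov U W : (W <= U)%VS ->
  (\dim (U :&: orthov W) + \dim W)%N = \dim U.
Proof.
move=> sWU; set K := (U :&: orthov W)%VS; apply/eqP.
have cap0 : (K :&: W = 0)%VS.
  apply/eqP; rewrite -subv0; apply/subvP => w; rewrite !memv_cap memv0.
  by case/andP=> /andP[_ /orthovP wW] /wW/eqP; rewrite dotmx_eq0.
rewrite eqn_leq -dimv_disjoint_sum // dimvS /=; last first.
  by rewrite subv_add capvSl.
rewrite dimv_disjoint_sum // -(limg_ker_dim (linfun
   (mulmxr (basis_mx W)^T : 'rV[R]_n -> 'rV[R]_(\dim W))) U) leq_add2l.
by apply: leq_trans (dimvS (subvf _)) _; rewrite dimvf /dim /= mul1n.
Qed.

(** The orthogonal of [H] in [U] is a line, so a normal vector exists and [xget] does not fall back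
    on its default 0. *)
Lemma normal_vectorP U H : (H <= U)%VS -> (\dim H).+1 = \dim U ->
  [/\ normal_vector U H \in U, normal_vector U H != 0
    & forall w, w \in H -> normal_vector U H *m w^T = 0].
Proof.
move=> sHU dimH; pose normal v := [/\ v \in U, v != 0
  & forall w, w \in H -> v *m w^T = 0].
apply: (@classical_sets.xgetPex _ 0 normal).
have dim1 : \dim (U :&: orthov H) = 1%N by have := dim_cap_orthov sHU; lia.
exists (vpick (U :&: orthov H)); have := memv_pick (U :&: orthov H).
rewrite memv_cap => /andP[vU /orthovP ortho]; split=> //.
  by rewrite vpick0 -dimv_eq0 dim1.
by move=> w /ortho/eqP; rewrite dotmxC => /eqP.
Qed.

(** [H] lies in the orthogonal of its normal within [U], and the dimensions agree. *)
Lemma memv_normal U H w : (H <= U)%VS -> (\dim H).+1 = \dim U -> w \in U ->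
  (w \in H) = (normal_vector U H *m w^T == 0).
Proof.
move=> sHU dimH wU; have [NU N0 NH] := normal_vectorP sHU dimH.
set N := normal_vector U H in NU N0 NH *.
have sNU : (<[N]> <= U)%VS by rewrite -memvE.
have -> : H = (U :&: orthov <[N]>)%VS.
  apply/eqP; rewrite eqEdim subv_cap sHU /=; apply/andP; split.
    apply/subvP => u uH; apply/orthovP => _ /vlineP[c ->].
    by rewrite -scalemxAl NH // scaler0.
  by have := dim_cap_orthov sNU; rewrite dim_vline N0; lia.
rewrite memv_cap wU; apply/orthovP/eqP => [-> | wN _ /vlineP[c ->]] //.
  exact: memv_line.
by rewrite -scalemxAl wN scaler0.
Qed.

Lemma normal_vector_inj U H K c :
    (H <= U)%VS -> (\dim H).+1 = \dim U -> (K <= U)%VS -> (\dim K).+1 = \dim U ->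
  normal_vector U H = c *: normal_vector U K -> H = K.
Proof.
move=> sHU dH sKU dK eq_norm; have [_ NH0 _] := normal_vectorP sHU dH.
have c0 : c != 0 by apply: contraNneq NH0 => c0; rewrite eq_norm c0 scale0r.
apply/vspaceP => w; have [wU | wU] := boolP (w \in U).
  rewrite (memv_normal sHU) // (memv_normal sKU) // eq_norm -scalemxAl.
  by rewrite scalemx_eq0 (negbTE c0).
by rewrite (contraNF (subvP sHU w) wU) (contraNF (subvP sKU w) wU).
Qed.

Lemma memv_bigcap (I : Type) (s : seq I) (Vs : I -> {vspace 'rV[R]_n}) w :
  (w \in \bigcap_(i <- s) Vs i)%VS = all (fun i => w \in Vs i) s.
Proof.
elim: s => [|i s IH] /=; first by rewrite big_nil memvf.
by rewrite big_cons memv_cap IH.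
Qed.

(** The hyperplanes meet in the orthogonal, within [U], of the span of their normals, so the
    codimension of the intersection is the rank of the normals. *)
Lemma free_normal U (s : seq {vspace 'rV[R]_n}) :
    (forall H, H \in s -> (H <= U)%VS /\ (\dim H).+1 = \dim U) ->
  free [seq normal_vector U H | H <- s]
    = (\dim (U :&: \bigcap_(H <- s) H) + size s == \dim U)%N.
Proof.
move=> hyp; set N := [seq _ | H <- s]; set W := <<N>>%VS.
have sWU : (W <= U)%VS.
  by apply/span_subvP => _ /mapP[H /hyp[sHU dH] ->]; case: (normal_vectorP sHU dH).
have -> : (U :&: \bigcap_(H <- s) H = U :&: orthov W)%VS.
  apply/vspaceP => w; rewrite !memv_cap memv_bigcap; case wU: (w \in U) => //=.
  apply/allP/orthovP => [allH | wW H Hs].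
    have /subvP sub : (W <= orthov <[w]>)%VS.
      apply/span_subvP => _ /mapP[H Hs ->]; apply/orthovP => _ /vlineP[c ->].
      have [sHU dH] := hyp H Hs; have := allH H Hs; rewrite (memv_normal sHU) //.
      by rewrite -scalemxAl dotmxC => /eqP->; rewrite scaler0.
    move=> v /sub/orthovP/(_ w (memv_line w))/eqP.
    by rewrite dotmxC => /eqP.
  have [sHU dH] := hyp H Hs; rewrite (memv_normal sHU dH) // wW //.
  by apply/memv_span/map_f.
rewrite -(dim_cap_orthov sWU) eqn_add2l /free size_map eq_sym.
by [].
Qed.

End Orthogonal.

(** * Finite sets versus lists of subspaces *)

Section Intersections.
Variables (F : fieldType) (vT : vectType F).
Implicit Types (X : {vspace vT}) (s : seq {vspace vT}) (B : {fset {vspace vT}}).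

Lemma bigcap_fset s :
  (\bigcap_(H <- [fset H in s]%fset) H = \bigcap_(H <- s) H)%VS.
Proof.
apply: eq_big_idem; first exact: capvv.
by move=> H; rewrite !inE.
Qed.

Lemma bigcap_intersections B s :
  {subset s <= B} -> (\bigcap_(H <- s) H)%VS \in intersections fullv B.
Proof.
move=> sB; apply/imfsetP; exists [fset H in s]%fset => /=.
  by rewrite fpowersetE; apply/fsubsetP => H; rewrite !inE; apply: sB.
by rewrite capfv bigcap_fset.
Qed.

Lemma intersections_bigcap B X :
  X \in intersections fullv B ->
  exists2 s : seq {vspace vT}, {subset s <= B} & X = (\bigcap_(H <- s) H)%VS.
Proof.
case/imfsetP => C /=; rewrite fpowersetE => /fsubsetP sCB ->.
by exists C; rewrite ?capfv.
Qed.

End Intersections.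

(** * Strata of the adjoint and the comparison of restrictions *)

Section Strata.
Variables (R : realType) (n k : nat) (A : {fset {vspace 'rV[R]_n}}).
Hypotheses (arrA : arrangement_in fullv A) (essA : essential fullv A).
Implicit Types (U X Y H : {vspace 'rV[R]_n}) (s t : seq {vspace 'rV[R]_n}).

Lemma dim_cap_hyperplane Y H : H \in A ->
  (\dim Y <= (\dim (Y :&: H)).+1)%N
  /\ (~~ (Y <= H)%VS -> \dim Y = (\dim (Y :&: H)).+1).
Proof.
case/arrA => _ dimH; have := dimv_sum_cap Y H; have := dimvS (subvf (Y + H)).
rewrite -dimH => le_sum eq_sum; split=> [|YH]; first by lia.
suff : (\dim H < \dim (Y + H))%N by lia.
rewrite ltnNge; apply: contra YH => le_dim.
have /eqP -> : H == (Y + H)%VS by rewrite eqEdim addvSr.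
exact: addvSl.
Qed.

Lemma dim_cap_bigcap Y t : {subset t <= A} ->
  (\dim Y <= \dim (Y :&: \bigcap_(H <- t) H) + size t)%N.
Proof.
elim: t => [|H t IH] sA; first by rewrite big_nil capvf addn0.
rewrite big_cons [(H :&: _)%VS]capvC capvA.
have [le_dim _] := dim_cap_hyperplane (Y :&: \bigcap_(K <- t) K) (sA H (mem_head _ _)).
have := IH (fun K Kt => sA K (mem_behead (Kt : K \in behead (H :: t)))).
by move: le_dim => /=; lia.
Qed.

(* As [A] is essential, independent hyperplanes of [U] extend to a basis. *)
Lemma extend_to_basis U s : {subset s <= A} ->
    (\dim (U :&: \bigcap_(H <- s) H) + size s)%N = \dim U ->
  exists t, [/\ {subset t <= A}, size (t ++ s) = \dim U
    & (U :&: \bigcap_(H <- t ++ s) H = 0)%VS].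
Proof.
move=> sA; have [m] := ubnP (\dim (U :&: \bigcap_(H <- s) H)).
elim: m s sA => // m IH s sA; rewrite ltnS => le_m dimU.
have [dim0 | dim_neq0] := eqVneq (\dim (U :&: \bigcap_(H <- s) H)) 0%N.
  by exists [::]; split=> //=; [rewrite -dimU dim0 | apply/eqP; rewrite -dimv_eq0 dim0].
have [H HA nsub] : exists2 H, H \in A & ~~ (U :&: \bigcap_(K <- s) K <= H)%VS.
  apply/hasP; apply: contraNT dim_neq0 => /hasPn nall.
  rewrite dimv_eq0 -subv0 -essA capfv; apply/subvP => w wY; rewrite memv_bigcap.
  by apply/allP => H /nall; rewrite negbK => /subvP; apply.
have [_ /(_ nsub) dimY] := dim_cap_hyperplane (U :&: \bigcap_(K <- s) K) HA.
have capE : (U :&: \bigcap_(K <- H :: s) K = U :&: \bigcap_(K <- s) K :&: H)%VS.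
  by rewrite big_cons [(H :&: _)%VS]capvC capvA.
have [||| t [tA sz cap0]] := IH (H :: s).
- by move=> K; rewrite inE => /predU1P[->|/sA].
- by rewrite capE; lia.
- by rewrite capE /=; lia.
exists (rcons t H); rewrite cat_rcons; split=> //.
by move=> K; rewrite mem_rcons inE => /predU1P[->|/tA].
Qed.

(** If the Plücker vector were on [adjoint_hyperplane k X] without [P] lying inside it, the
    intersection with [P] would be a lattice element strictly above [P] containing that vector,
    against openness. *)
Lemma stratum_mem P U X : P \in adjoint_lattice k A -> adjoint_stratum A P U ->
    X \in intersections fullv A -> rank_in X = k ->
  (plucker_vec k U \in adjoint_hyperplane k X) = (P <= adjoint_hyperplane k X)%VS.
Proof.
move=> PL /andP[_ /andP[vP /forallP open_v]] XL rkX.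
apply/idP/subvP => [vX | sPX]; last exact: sPX.
have HX : adjoint_hyperplane k X \in adjoint k A.
  by apply/imfsetP; exists X; rewrite //= inE XL rkX eqxx.
set H := adjoint_hyperplane k X in vX HX *.
have YL : (H :&: P)%VS \in adjoint_lattice k A.
  have [s sA ->] := intersections_bigcap PL.
  have := @bigcap_intersections _ _ (adjoint k A) (H :: s); rewrite big_cons; apply.
  by move=> K; rewrite inE => /predU1P[->|/sA].
have := open_v [` YL]%fset; rewrite /lat_lt /lat_le capvSr memv_cap vX vP implybF /=.
by rewrite negbK => /eqP {1}->; apply/subvP/capvSl.
Qed.

Lemma stratum_weak_map P1 P2 U1 U2 s :
    P1 \in adjoint_lattice k A -> P2 \in adjoint_lattice k A -> lat_le P1 P2 ->
    adjoint_stratum A P1 U1 -> adjoint_stratum A P2 U2 -> {subset s <= A} ->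
    (\dim (U2 :&: \bigcap_(H <- s) H) + size s)%N = \dim U2 ->
  (\dim (U1 :&: \bigcap_(H <- s) H) + size s)%N = \dim U1.
Proof.
move=> P1L P2L leP U1S U2S sA dim2.
have [t [tA sz cap0]] := extend_to_basis sA dim2.
have dU1 : \dim U1 = k by case/andP: U1S => /eqP.
have dU2 : \dim U2 = k by case/andP: U2S => /eqP.
set X := (\bigcap_(H <- t ++ s) H)%VS in cap0.
have tsA : {subset t ++ s <= A}.
  by move=> H; rewrite mem_cat => /orP[/tA|/sA].
have XL : X \in intersections fullv A by apply: bigcap_intersections.
have dimf : \dim {:'rV[R]_n} = n by rewrite dimvf /dim /= mul1n.
(* [X] has codimension at most k as an intersection of k hyperplanes, and at least k since it meets
   [U2] only in 0. *)
have dX : (k + \dim X)%N = n.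
  apply/eqP; rewrite -[X in _ == X]dimf eqn_leq.
  have := dim_cap_bigcap fullv tsA; rewrite capfv sz dU2 addnC => ->.
  by rewrite -dU2 -dimv_disjoint_sum // dimvS ?subvf.
have rkX : rank_in X = k.
  exact: etrans (congr1 (subn^~ (\dim X)) (esym dX)) (addnK _ _).
(* If [U1] met [X], then [P2], contained in [P1], would lie in the hyperplane of [X], so [U2] would
   meet [X]. *)
have cap1 : (U1 :&: X = 0)%VS.
  have dX1 : (\dim U1 + \dim X)%N = n by rewrite dU1.
  have dX2 : (\dim U2 + \dim X)%N = n by rewrite dU2.
  have := mem_adjoint_hyperplane_cap dX1; have := mem_adjoint_hyperplane_cap dX2.
  rewrite dU1 dU2 (stratum_mem P2L U2S) // (stratum_mem P1L U1S) //.
  rewrite cap0 eqxx /= => /negbT nP2 eqP1; apply/eqP; move: nP2; apply: contraNT.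
  by rewrite -eqP1; apply: subv_trans.
(* Cutting by [s] loses at most [size s] dimensions, and the rest dies after [size t] further cuts;
   since [size t + size s] is k, both bounds are sharp. *)
have := dim_cap_bigcap U1 sA; have := dim_cap_bigcap (U1 :&: \bigcap_(H <- s) H) tA.
have -> : (U1 :&: \bigcap_(H <- s) H :&: \bigcap_(H <- t) H)%VS = 0%VS.
  by rewrite -cap1 /X big_cat /= -capvA; congr (_ :&: _)%VS; apply: capvC.
by move: sz; rewrite dimv0 size_cat dU1 dU2; lia.
Qed.

Lemma restriction_arrangement U : arrangement_in U (restriction A U).
Proof.
move=> K /imfsetP[H /=]; rewrite inE => /andP[HA nUH] ->; split; first exact: capvSr.
by have [_ /(_ nUH)] := dim_cap_hyperplane U HA; rewrite capvC.
Qed.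

Lemma restriction_normal_neq0 U (K : restriction A U) : normal_vector U (val K) != 0.
Proof. by have [sKU /(normal_vectorP sKU)[]] := restriction_arrangement (valP K). Qed.

(** Rephrases independence of traces in terms of the hyperplanes of [A], where [U1] and [U2] can be
    compared. *)
Lemma free_normal_restriction U s :
    {subset s <= A} -> {in s, forall H, ~~ (U <= H)%VS} ->
  free [seq normal_vector U (H :&: U)%VS | H <- s]
    = (\dim (U :&: \bigcap_(H <- s) H) + size s == \dim U)%N.
Proof.
move=> sA nU.
rewrite (map_comp (normal_vector U) (fun H => (H :&: U)%VS)) free_normal; last first.
  move=> _ /mapP[H Hs ->]; apply/restriction_arrangement/imfsetP.
  by exists H; rewrite //= inE sA ?nU.
rewrite size_map big_map.
suff -> : (U :&: \bigcap_(H <- s) (H :&: U) = U :&: \bigcap_(H <- s) H)%VS by [].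
apply/vspaceP => w; rewrite !memv_cap !memv_bigcap; case wU: (w \in U) => //=.
by apply: eq_all => H; rewrite memv_cap wU andbT.
Qed.

(** Several hyperplanes of [A] may have the same trace on [U2]; the map chooses one for each trace
    and sends it to its trace on [U1]. *)
Lemma restriction_weak_map U1 U2 :
    (forall s, {subset s <= A} ->
      (\dim (U2 :&: \bigcap_(H <- s) H) + size s)%N = \dim U2 ->
      (\dim (U1 :&: \bigcap_(H <- s) H) + size s)%N = \dim U1) ->
  exists2 g : restriction A U2 -> restriction A U1, injective g
    & forall S, vindep (fun K : restriction A U2 => normal_vector U2 (val K)) S ->
        vindep (fun K : restriction A U1 => normal_vector U1 (val K)) (g @: S).
Proof.
move=> weak.
have lift_mem (K : restriction A U2) :
    exists H, [/\ H \in A, ~~ (U2 <= H)%VS & val K = (H :&: U2)%VS].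
  have /imfsetP[H /=] := valP K.
  by rewrite inE => /andP[HA nH] eqK; exists H.
have [t tP] := fin_all_exists lift_mem.
(* For a single hyperplane, [weak] says that it cuts [U1] properly if it cuts [U2] properly. *)
have tU1 K : ~~ (U1 <= t K)%VS.
  have [tA nt _] := tP K; have [_ /(_ nt) dim2] := dim_cap_hyperplane U2 tA.
  have sA : {subset [:: t K] <= A} by move=> H; rewrite inE => /eqP->.
  have := weak _ sA; rewrite !big_seq1 !addn1 -dim2 => /(_ erefl) dim1.
  by apply/negP => /capv_idPl cap; move: dim1; rewrite cap; lia.
have image_mem (K : restriction A U2) :
    exists L : restriction A U1, val L = (t K :&: U1)%VS.
  have [tA _ _] := tP K.
  have KA : (t K :&: U1)%VS \in restriction A U1.
    by apply/imfsetP; exists (t K); rewrite //= inE tA tU1.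
  by exists [` KA]%fset.
have [g gE] := fin_all_exists image_mem.
(* Stated for a list, since [g @: S] is enumerated by these images only once [g] is known to be
   injective. *)
have weak_g (S : {set restriction A U2}) :
    vindep (fun K : restriction A U2 => normal_vector U2 (val K)) S ->
    free [seq normal_vector U1 (val (g K)) | K <- enum S].
  have sA : {subset [seq t K | K <- enum S] <= A}.
    by move=> _ /mapP[K _ ->]; have [] := tP K.
  have eq2 : [seq normal_vector U2 (val K) | K <- enum S]
      = [seq normal_vector U2 (H :&: U2)%VS | H <- [seq t K | K <- enum S]].
    by rewrite -map_comp; apply: eq_map => K /=; have [_ _ ->] := tP K.
  have eq1 : [seq normal_vector U1 (val (g K)) | K <- enum S]
      = [seq normal_vector U1 (H :&: U1)%VS | H <- [seq t K | K <- enum S]].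
    by rewrite -map_comp; apply: eq_map => K /=; rewrite gE.
  rewrite /vindep eq1 eq2.
  rewrite !free_normal_restriction //; last 2 first.
  - by move=> _ /mapP[K _ ->].
  - by move=> _ /mapP[K _ ->]; have [] := tP K.
  by move=> /eqP/(weak _ sA)/eqP.
(* Distinct traces on [U2] have nonproportional normals, hence form an independent pair; a free list
   has no repetition, so their images differ. *)
have g_inj : injective g.
  move=> K L eq_g; apply: contraTeq isT => neq.
  have /weak_g/free_uniq :
      vindep (fun K : restriction A U2 => normal_vector U2 (val K)) [set K; L].
    rewrite vindepU1 ?inE // [vindep _ _]vindep1 restriction_normal_neq0 andbT.
    apply: contra neq => normK; apply/eqP/val_inj.
    have /vlineP[c] : normal_vector U2 (val K) \in <[normal_vector U2 (val L)]>%VS.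
      by apply: subvP normK; apply/vspan_subP => M /set1P->; apply: memv_line.
    have [sK dK] := restriction_arrangement (valP K).
    have [sL dL] := restriction_arrangement (valP L).
    exact: normal_vector_inj.
  move/dinjectiveP => /(_ K L); rewrite !inE !eqxx orbT => /(_ isT isT).
  by rewrite eq_g => /(_ erefl)/eqP; rewrite (negbTE neq).
exists g => // S /weak_g; rewrite /vindep; congr is_true.
rewrite (map_comp (fun K : restriction A U1 => normal_vector U1 (val K)) g).
apply/perm_free/perm_map/uniq_perm.
- by rewrite map_inj_uniq ?enum_uniq.
- exact: enum_uniq.
move=> K; rewrite mem_enum; apply/mapP/imsetP => -[L LS ->].
  by exists L; rewrite // -mem_enum.
by exists L; rewrite // mem_enum.
Qed.

End Strata.

Theorem theorem1p3 (R : realType) (n k : nat) (A : {fset {vspace 'rV[R]_n}})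
  (arrA : arrangement_in fullv A) (essA : essential fullv A) (ltkn : (k < n)%N)
  (P1 P2 : {vspace plucker_space R n k})
  (P1L : P1 \in adjoint_lattice k A) (P2L : P2 \in adjoint_lattice k A)
  (leP12 : lat_le P1 P2)
  (U1 U2 : {vspace 'rV[R]_n})
  (U1S : adjoint_stratum A P1 U1) (U2S : adjoint_stratum A P2 U2)
  (i : nat) (leik : (i <= k)%N) :
  (arr_indep_number U2 (restriction A U2) i
     <= arr_indep_number U1 (restriction A U1) i)%N
  /\ `|arr_whitney U2 (restriction A U2) i|
     <= `|arr_whitney U1 (restriction A U1) i|.
Proof.
have [g g_inj g_indep] := restriction_weak_map arrA
  (fun s sA => stratum_weak_map arrA essA P1L P2L leP12 U1S U2S sA).
split; first exact: weak_map_indep_number g_inj g_indep i.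
exact: (@weak_map_whitney _ _ _ _ _ _ _ g (restriction_normal_neq0 arrA (U := U1))
  (restriction_normal_neq0 arrA (U := U2)) g_inj g_indep i).
Qed.
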